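(* Let $r\in\mathbb R_{\ge 2}$ be irrational, and let $(p_n)_n,(q_n)_n$ be sequences of positive integers with $p_n/q_n\ge 2$ for all $n$ and $p_n/q_n\to r$. Then the sequence of fraction graphs $E_{p_n/q_n}$ converges, in the asymptotic spectrum distance on $\mathcal G_\infty$, to the open circle graph $E_r^{\mathrm o}$.
   Context: Graphs are simple and may be infinite. $E_n$ denotes the graph with $n$ vertices and no edges, $G\sqcup H$ the disjoint union, and $G\boxtimes H$ the strong product: its vertex set is $V(G)\times V(H)$, and distinct $(a,x),(b,y)$ are adjacent iff ($a=b$ or $\{a,b\}\in E(G)$) and ($x=y$ or $\{x,y\}\in E(H)$). A cohomomorphism $G\to H$ is a map $f:V(G)\to V(H)$ such that for all distinct non-adjacent $u,v\in V(G)$ the vertices $f(u),f(v)$ are distinct and non-adjacent in $H$. Write $G\le H$ if there is a cohomomorphism $G\to H$. $\mathcal G_\infty$ is the set of all (finite or infinite) graphs with cardinality at most that of $\mathbb R$ and with finite clique covering number (i.e. whose vertex set can be covered by finitely many cliques). $\mathcal X_\infty$ is the set of all maps $F:\mathcal G_\infty\to\mathbb R_{\ge 0}$ with $F(G\sqcup H)=F(G)+F(H)$, $F(G\boxtimes H)=F(G)F(H)$, $F(E_n)=n$ for all $n\in\mathbb N$, and $G\le H\Rightarrow F(G)\le F(H)$. The asymptotic spectrum distance on $\mathcal G_\infty$ is $d(G,H)=\sup_{F\in\mathcal X_\infty}|F(G)-F(H)|$, and $G_i$ converges to $H$ if $d(G_i,H)\to0$. For positive integers $p,q$ with $p/q\ge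 2$, the fraction graph $E_{p/q}$ has vertex set $\{0,\dots,p-1\}$, and distinct $u,v$ are adjacent iff $u-v \bmod p<q$ or $v-u\bmod p<q$. Let $C$ be a circle of unit circumference, with distance measured along the circle. For $r\in\mathbb R_{\ge2}$, $E_r^{\mathrm o}$ is the graph with vertex set $C$ in which two distinct vertices are adjacent iff their distance on $C$ is strictly less than $1/r$. *)

(* Defs.v *)
From HB Require Import structures.
From mathcomp Require Import all_boot all_order all_algebra.
From mathcomp Require Import all_classical all_reals all_analysis.
From mathcomp Require Import lra.
Set Implicit Arguments.
Unset Strict Implicit.
Unset Printing Implicit Defensive.
Import Order.TTheory GRing.Theory Num.Theory.
Import numFieldNormedType.Exports.
Local Open Scope classical_set_scope.
Local Open Scope ring_scope.

Record graph := Graph {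
  vertex :> Type;
  adj : vertex -> vertex -> Prop;
  adj_sym : forall u v, adj u v -> adj v u;
  adj_irr : forall u, ~ adj u u }.

Definition clique (G : graph) (K : set G) :=
  forall u v, K u -> K v -> u <> v -> adj u v.

Definition finite_clique_cover (G : graph) :=
  exists (n : nat) (K : 'I_n -> set G),
    (forall i, clique (K i)) /\ \bigcup_i K i = [set: G].

Definition cohomomorphism (G H : graph) (f : G -> H) :=
  forall u v : G, u <> v -> ~ adj u v -> f u <> f v /\ ~ adj (f u) (f v).

Definition cohom_le (G H : graph) := exists f : G -> H, cohomomorphism f.

Section operations.

Definition edgeless (n : nat) : graph :=
  @Graph 'I_n (fun _ _ => False) (fun _ _ a => a) (fun _ a => a).

Variables G H : graph.

Definition disjoint_union_adj (u v : G + H) : Prop :=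
  match u, v with
  | inl a, inl b => adj a b
  | inr x, inr y => adj x y
  | _, _ => False
  end.

Lemma disjoint_union_sym u v :
  disjoint_union_adj u v -> disjoint_union_adj v u.
Proof. by case: u v => [a|x] [b|y] //=; exact: adj_sym. Qed.

Lemma disjoint_union_irr u : ~ disjoint_union_adj u u.
Proof. by case: u => [a|x] /=; exact: adj_irr. Qed.

Definition disjoint_union : graph :=
  Graph disjoint_union_sym disjoint_union_irr.

Definition strong_product_adj (u v : G * H) : Prop :=
  [/\ u <> v, u.1 = v.1 \/ adj u.1 v.1 & u.2 = v.2 \/ adj u.2 v.2].

Lemma strong_product_sym u v :
  strong_product_adj u v -> strong_product_adj v u.
Proof.
case=> uv h1 h2; split; first by move=> vu; exact/uv/esym.
- by case: h1 => [->|/adj_sym]; [left|right].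
- by case: h2 => [->|/adj_sym]; [left|right].
Qed.

Lemma strong_product_irr u : ~ strong_product_adj u u.
Proof. by case. Qed.

Definition strong_product : graph :=
  Graph strong_product_sym strong_product_irr.

End operations.

Section fraction_graph.
Variables p q : nat.

Definition fraction_adj (u v : 'I_p) : Prop :=
  u <> v /\ ((((u%:Z - v%:Z) %% p%:Z)%Z < q%:Z) \/
             (((v%:Z - u%:Z) %% p%:Z)%Z < q%:Z)).

Lemma fraction_sym u v : fraction_adj u v -> fraction_adj v u.
Proof.
by case=> uv h; split; [move=> vu; exact/uv/esym | case: h; [right|left]].
Qed.

Lemma fraction_irr u : ~ fraction_adj u u.
Proof. by case. Qed.

Definition fraction_graph : graph := Graph fraction_sym fraction_irr.

End fraction_graph.

Section open_circle.
Variable R : realType.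

(* The circle of unit circumference is R/Z, represented by [0, 1[. *)
Definition circle := {x : R | 0 <= x < 1}.

Definition circle_dist (x y : circle) : R :=
  Num.min `|val x - val y| (1 - `|val x - val y|).

Variable r : R.

Definition open_circle_adj (x y : circle) : Prop :=
  x <> y /\ circle_dist x y < 1 / r.

Lemma open_circle_sym x y : open_circle_adj x y -> open_circle_adj y x.
Proof.
case=> xy h; split; first by move=> yx; exact/xy/esym.
by rewrite /circle_dist distrC.
Qed.

Lemma open_circle_irr x : ~ open_circle_adj x x.
Proof. by case. Qed.

Definition open_circle_graph : graph := Graph open_circle_sym open_circle_irr.

End open_circle.

(* Vertex types range over a fixed universe; as the invariants below are
   monotone under cohomomorphisms, they do not distinguish isomorphic graphs. *)
Record Ginf (R : realType) := MkGinf {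
  ginf_graph :> graph;
  ginf_card : ([set: ginf_graph] #<= [set: R])%card;
  ginf_cover : finite_clique_cover ginf_graph }.

Section membership.
Variable R : realType.

Lemma card_le_realP (T : Type) :
  ([set: T] #<= [set: R])%card <-> exists f : T -> R, injective f.
Proof.
split=> [/(@pcard_injP T R)[f finj]|[f finj]].
  by exists f => x y; apply: finj; rewrite in_setT.
by apply/(@pcard_injP T R); exists f => x y _ _; exact: finj.
Qed.

Let psum (A : nat -> bool) n : R := \sum_(i < n) (A i)%:R * 3^-1 ^+ i.

Let psum_ub A k n : A k = false -> psum A n <= psum A k + 3^-1 ^+ k / 2.
Proof.
move=> Ak; have pw i : 0 < 3^-1 ^+ i :> R by rewrite exprn_gt0.
have b01 (b : bool) : (0 <= (b%:R : R)) && ((b%:R : R) <= 1) by case: b; rewrite ?lexx ler01.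
have mono m j : psum A m <= psum A (m + j).
  elim: j => [|j IH]; first by rewrite addn0.
  rewrite addnS (le_trans IH)// /psum big_ord_recr/= lerDl.
  by rewrite mulr_ge0// ?(ltW (pw _))//; case/andP: (b01 (A (m + j)%N)).
have step j : psum A (k.+1 + j) + 3^-1 ^+ (k + j) / 2
              <= psum A k + 3^-1 ^+ k / 2.
  elim: j => [|j IH].
    by rewrite !addn0 /psum big_ord_recr/= Ak mul0r addr0.
  apply: le_trans IH; rewrite addnS /psum big_ord_recr/= -/(psum _ _).
  rewrite addnS addSn exprS; have := pw (k + j)%N.
  set t := 3^-1 ^+ _ => t0; case/andP: (b01 (A (k + j).+1)).
  by case: (A _) => _ _ /=; lra.
have [nk|kn] := leqP n k.
  by rewrite -(subnKC nk) (le_trans (mono n (k - n)%N))// lerDl divr_ge0// ltW.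
rewrite -(subnKC kn); apply: le_trans (step (n - k.+1)%N).
by rewrite lerDl divr_ge0// ltW.
Qed.

Let real_of_bits A : R := sup (range (psum A)).

Let real_of_bits_lt A B k :
  (forall i, (i < k)%N -> A i = B i) -> A k = false -> B k = true ->
  real_of_bits A < real_of_bits B.
Proof.
move=> AB Ak Bk; have pk : 0 < 3^-1 ^+ k :> R by rewrite exprn_gt0.
have eqk : psum A k = psum B k.
  by apply: eq_bigr => i _; rewrite AB.
have Aub : real_of_bits A <= psum A k + 3^-1 ^+ k / 2.
  apply: ge_sup; first by exists (psum A 0), 0%N.
  by move=> _ [n _ <-]; exact: psum_ub.
have Bub : has_ubound (range (psum B)).
  exists (3 / 2) => _ [n _ <-].
  pose C i := if i is j.+1 then B j else false.
  have := @psum_ub C 0 n.+1 erefl.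
  rewrite /psum big_ord0 big_ord_recl/= mul0r !add0r expr0.
  under eq_bigr do rewrite /bump/= add1n exprS mulrCA.
  by rewrite -mulr_sumr; set s := \sum_(_ < _) _; lra.
have : psum B k.+1 <= real_of_bits B by apply: ub_le_sup => //; exists k.+1.
rewrite /psum big_ord_recr/= -/(psum _ _) Bk mul1r -eqk.
by lra.
Qed.

Let real_of_bits_inj : injective real_of_bits.
Proof.
move=> A B eAB; apply/funext => k.
elim/ltn_ind: k => k IH.
case Ak: (A k); case Bk: (B k) => //.
- have := @real_of_bits_lt B A k (fun i ik => esym (IH i ik)) Bk Ak.
  by rewrite eAB ltxx.
- have := @real_of_bits_lt A B k IH Ak Bk.
  by rewrite eAB ltxx.
Qed.

Let cut (x : R) (n : nat) : bool :=
  if unpickle n is Some a then ratr a < x else false.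

Let cut_inj : injective cut.
Proof.
suff H x y : x < y -> cut x <> cut y.
  move=> x y cxy; have [xy|yx|//] := ltgtP x y.
    by have := H _ _ xy.
  by have := H _ _ yx; rewrite cxy.
move=> xy cxy; have [a] := rat_in_itvoo xy.
rewrite in_itv/= => /andP[xa ay].
have := congr1 (fun f => f (pickle a)) cxy.
by rewrite /cut pickleK ay ltNge (ltW xa).
Qed.

Lemma real_pair_inj : exists f : R * R -> R, injective f.
Proof.
pose g (z : R * R) n := if odd n then cut z.1 n./2 else cut z.2 n./2.
exists (real_of_bits \o g) => z w /real_of_bits_inj e.
have e1 : z.1 = w.1.
  apply: cut_inj; apply/funext => n.
  have := congr1 (fun f => f n.*2.+1) e.
  by rewrite /g /= odd_double/= uphalf_double.
have e2 : z.2 = w.2.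
  apply: cut_inj; apply/funext => n.
  have := congr1 (fun f => f n.*2) e.
  by rewrite /g /= odd_double/= doubleK.
by case: z w e1 e2 {e} => [a b] [c d] /= -> ->.
Qed.

Lemma ord_card n : ([set: 'I_n] #<= [set: R])%card.
Proof.
apply/card_le_realP; exists (fun i : 'I_n => (i : nat)%:R) => i j.
by move=> /eqP; rewrite eqr_nat => /eqP /val_inj.
Qed.

Lemma ord_cover n (a : 'I_n -> 'I_n -> Prop) s i :
  finite_clique_cover (@Graph 'I_n a s i).
Proof.
exists n, (fun i => [set i]); split; first by move=> k u v /= -> ->.
by apply/seteqP; split=> // u _; exists u.
Qed.

Definition ginf_edgeless n : Ginf R :=
  @MkGinf R (edgeless n) (ord_card n) (ord_cover _ _).

Definition ginf_fraction p q : Ginf R :=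
  @MkGinf R (fraction_graph p q) (ord_card p) (ord_cover _ _).

Lemma disjoint_union_card (G H : Ginf R) :
  ([set: disjoint_union G H] #<= [set: R])%card.
Proof.
have /card_le_realP[f finj] := ginf_card G.
have /card_le_realP[g ginj] := ginf_card H.
have [h hinj] := real_pair_inj.
apply/card_le_realP.
exists (fun u => h (match u with inl a => (0, f a) | inr x => (1, g x) end)).
move=> [a|x] [b|y] /hinj [].
- by move=> /finj ->.
- by move=> /esym/eqP; rewrite oner_eq0.
- by move=> /eqP; rewrite oner_eq0.
- by move=> /ginj ->.
Qed.

Lemma disjoint_union_cover (G H : Ginf R) :
  finite_clique_cover (disjoint_union G H).
Proof.
have [n [K [Kc KT]]] := ginf_cover G.
have [m [L [Lc LT]]] := ginf_cover H.
exists (n + m)%N, (fun i => match fintype.split i with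
  | inl j => inl @` K j | inr j => inr @` L j end); split.
  move=> i; case: (fintype.split i) => j _ _ [a Ka <-] [b Kb <-] ab /=.
    by apply: (Kc j) => // e; apply: ab; rewrite e.
  by apply: (Lc j) => // e; apply: ab; rewrite e.
apply/seteqP; split=> // -[a|x] _.
  have : [set: G] a by [].
  by rewrite -KT => -[i _ Ki]; exists (unsplit (inl i)) => //; rewrite unsplitK; exists a.
have : [set: H] x by [].
by rewrite -LT => -[i _ Li]; exists (unsplit (inr i)) => //; rewrite unsplitK; exists x.
Qed.

Definition ginf_union (G H : Ginf R) : Ginf R :=
  MkGinf (disjoint_union_card G H) (disjoint_union_cover G H).

Lemma strong_product_card (G H : Ginf R) :
  ([set: strong_product G H] #<= [set: R])%card.
Proof.
have /card_le_realP[f finj] := ginf_card G.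
have /card_le_realP[g ginj] := ginf_card H.
have [h hinj] := real_pair_inj.
apply/card_le_realP; exists (fun u => h (f u.1, g u.2)).
by move=> [a x] [b y] /hinj[/finj /= -> /ginj /= ->].
Qed.

Lemma strong_product_cover (G H : Ginf R) :
  finite_clique_cover (strong_product G H).
Proof.
have [n [K [Kc KT]]] := ginf_cover G.
have [m [L [Lc LT]]] := ginf_cover H.
pose N := #|{: 'I_n * 'I_m}|.
exists N, (fun i : 'I_N => K (enum_val i).1 `*` L (enum_val i).2); split.
  move=> i; case: (enum_val i) => j k [a x] [b y] /= [Ka Lx] [Kb Ly] ne.
  split=> //=.
    by have [->|ab] := pselect (a = b); [left|right; exact: (Kc j)].
  by have [->|xy] := pselect (x = y); [left|right; exact: (Lc k)].
apply/seteqP; split=> // -[a x] _.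
have : [set: G] a by [].
have : [set: H] x by [].
rewrite -KT -LT => -[j _ Lj] [i _ Ki].
by exists (enum_rank (i, j)) => //; rewrite enum_rankK.
Qed.

Definition ginf_strong (G H : Ginf R) : Ginf R :=
  MkGinf (strong_product_card G H) (strong_product_cover G H).

Lemma open_circle_card (r : R) : ([set: open_circle_graph r] #<= [set: R])%card.
Proof. by apply/card_le_realP; exists val => x y; exact: val_inj. Qed.

Lemma open_circle_cover (r : R) : 2 <= r ->
  finite_clique_cover (open_circle_graph r).
Proof.
move=> r2; have r0 : 0 < r by lra.
pose k := (Num.truncn r).+1.
have rk : r < k%:R by rewrite /k truncnS_gt.
have k0 : 0 < k%:R :> R by lra.
exists k, (fun i => [set x : circle R | i%:R <= val x * k%:R < i.+1%:R]); split.
  move=> i x y /= /andP[xi xi'] /andP[yi yi'] xy; split=> //.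
  rewrite gt_min; apply/orP; left; apply: (@lt_trans _ _ (1 / k%:R)).
    rewrite ltr_pdivlMr// -[X in _ * X](gtr0_norm k0) -normrM.
    rewrite ltr_norml mulrBl; move: xi xi' yi yi'; rewrite -natr1.
    set a := val x * _; set b := val y * _; set j := _%:R.
    by move=> *; apply/andP; split; lra.
  by rewrite !div1r ltf_pV2// posrE.
apply/seteqP; split=> // x _; have /andP[x0 x1] := valP x.
have xk0 : 0 <= val x * k%:R by rewrite mulr_ge0// ltW.
have /andP[h1 h2] := truncn_itv xk0.
have ik : (Num.truncn (val x * k%:R) < k)%N.
  by rewrite truncn_lt_nat// gtr_pMl.
by exists (Ordinal ik) => //=; apply/andP.
Qed.

Definition ginf_open_circle (r : R) (r2 : 2 <= r) : Ginf R :=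
  MkGinf (open_circle_card r) (open_circle_cover r2).

(* [Ginf R] lives above the universe of [classical_sets.set], so this is a
   plain predicate, and the index set below is spelled with [exists2]. *)
Definition asymp_spectrum (F : Ginf R -> R) : Prop :=
  [/\ forall G, 0 <= F G,
      forall G H, F (ginf_union G H) = F G + F H,
      forall G H, F (ginf_strong G H) = F G * F H,
      forall n, F (ginf_edgeless n) = n%:R &
      forall G H : Ginf R, cohom_le G H -> F G <= F H].

Definition spectrum_gaps (G H : Ginf R) : set R :=
  [set d | exists2 F, asymp_spectrum F & `|F G - F H| = d].

Definition asymp_dist (G H : Ginf R) : R :=
  sup (spectrum_gaps G H).

Lemma asymp_spectrum_bounded (G : Ginf R) :
  exists n : nat, forall F, asymp_spectrum F -> F G <= n%:R.
Proof.
have [n [K [Kc KT]]] := ginf_cover G.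
exists n => F [_ _ _ Fn Fle]; rewrite -Fn; apply: Fle.
have cP (u : G) : exists i, K i u.
  have : [set: G] u by [].
  by rewrite -KT => -[i _ Ki]; exists i.
exists (fun u => projT1 (cid (cP u))) => u v uv nuv; split=> // e; apply: nuv.
move: e; case: (cid (cP u)) (cid (cP v)) => i Ki [j Kj] /= ij.
by rewrite -ij in Kj; exact: (Kc i).
Qed.

(* [sup] is 0 by convention on unbounded sets; this never happens here. *)
Lemma asymp_dist_has_ubound (G H : Ginf R) :
  has_ubound (spectrum_gaps G H).
Proof.
have [n nG] := asymp_spectrum_bounded G.
have [m mH] := asymp_spectrum_bounded H.
exists (n%:R + m%:R) => _ [F XF <-]; have [F0 _ _ _ _] := XF.
rewrite (le_trans (ler_normB _ _))// !ger0_norm//.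
by rewrite lerD ?nG ?mH.
Qed.

End membership.

(* Main.v *)
Require Import Defs.
From HB Require Import structures.
From mathcomp Require Import all_boot all_order all_algebra.
From mathcomp Require Import all_classical all_reals all_analysis.
From mathcomp Require Import zify ring lra.
Set Implicit Arguments.
Unset Strict Implicit.
Unset Printing Implicit Defensive.
Import Order.TTheory GRing.Theory Num.Theory.
Import numFieldNormedType.Exports.
Local Open Scope classical_set_scope.
Local Open Scope ring_scope.

(** The fraction graphs are monotone: E_(a/b) <= E_(c/d) as soon as
    a/b <= c/d, and likewise E_(p'/q') <= E_r^o <= E_(p/q) whenever
    p'/q' <= r <= p/q; in each case the map rescales the circle, rounding
    down where the target is discrete. So if p'/q' < r < p/q, then for large n
    both E_(p_n/q_n) and E_r^o lie between E_(p'/q') and E_(p/q), and it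
    suffices to make F(E_(p/q)) - F(E_(p'/q')) small, uniformly in the spectral
    point F.

    Take p q' - q p' = 1. Then the rounding map i |-> floor(i p' / p) is a
    cohomomorphism to E_(p'/q') on E_(p/q) with the vertex 0 removed
    ([fraction_punctured_cohom]): the rounding error that would lower
    p/q to p'/q' hits exactly one vertex. As E_(p/q) is vertex-transitive, its
    p rotations give p partial cohomomorphisms to E_(p'/q') such that each
    vertex is in the domain of p - 1 of them. Such a family bounds every
    spectral point: (p - 1) F(E_(p/q)) <= p F(E_(p'/q'))
    ([fractional_cohom_spectrum]). Indeed the n-th strong powers of the maps
    are p^n partial maps, each vertex of the n-th power lying in (p - 1)^n
    domains, so that greedily O(n (p/(p-1))^n) of these domains cover all
    vertices; giving each domain its own colour yields a cohomomorphism from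
    the n-th power of E_(p/q) to that many disjoint copies of the n-th power of
    E_(p'/q'), and the factor O(n) disappears on taking n-th roots.

    Hence F(E_(p/q)) - F(E_(p'/q')) <= F(E_(p/q)) / p, and F(E_(p/q)) is bounded
    by a constant as p/q stays bounded. It remains to find such pairs with p
    arbitrarily large ([irrational_neighbours]): p/q is the fraction of least
    denominator in a short interval to the right of r, and p'/q' is its lower
    Farey neighbour, which has a smaller denominator and so cannot lie in that
    interval; since r is irrational, p'/q' < r. *)

(** * Separated vertices and fraction graphs *)

(** The relation that cohomomorphisms preserve: the edges of the complement
    graph. *)
Definition separated (G : graph) (u v : G) : Prop := u <> v /\ ~ adj u v.

Lemma separated_sym (G : graph) (u v : G) : separated u v -> separated v u.
Proof. by move=> [uv nuv]; split=> [/esym|/adj_sym]. Qed.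

(** The complement of a strong product is the co-normal product of the
    complements, which is why products of cohomomorphisms can be taken
    coordinatewise. *)
Lemma separated_strong (G H : graph) (u v : strong_product G H) :
  separated u v <-> separated u.1 v.1 \/ separated u.2 v.2.
Proof.
split.
  move=> [uv nuv].
  have [e1|e1] := pselect (u.1 = v.1 \/ adj u.1 v.1); last first.
    by left; split=> h; apply: e1; [left|right].
  have [e2|e2] := pselect (u.2 = v.2 \/ adj u.2 v.2); last first.
    by right; split=> h; apply: e2; [left|right].
  by case: nuv.
by case=> -[ne na]; (split=> [e|[_ h1 h2]]; [apply: ne; rewrite e|tauto]).
Qed.

(** For v < u the two residues of the definition are u - v and p - (u - v), so
    that separation becomes a pair of linear inequalities on naturals. *)
Lemma fraction_separatedP (p q : nat) (u v : 'I_p) :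
  (0 < q)%N -> (v < u)%N ->
  @separated (fraction_graph p q) u v <-> (q <= u - v)%N /\ (q + (u - v) <= p)%N.
Proof.
move=> q0 vu; have up := ltn_ord u.
have Euv : ((u%:Z - v%:Z) %% p%:Z)%Z = (u - v)%N%:Z by rewrite modz_small; lia.
have Evu : ((v%:Z - u%:Z) %% p%:Z)%Z = (p - (u - v))%N%:Z.
  by rewrite -(modzMDl 1) mul1r modz_small; lia.
rewrite /separated/= /fraction_adj Euv Evu; split.
  move=> [ne na]; split; apply: contrapT => h; apply: na; split=> //; lia.
by move=> [h1 h2]; split=> [e|[_]]; [rewrite e in vu; lia|lia].
Qed.

Lemma fraction_separated_ltn (p q : nat) (H : graph) (D : 'I_p -> bool)
    (f : fraction_graph p q -> H) :
  (forall u v : 'I_p, D u -> D v -> (v < u)%N ->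
     @separated (fraction_graph p q) u v -> separated (f u) (f v)) ->
  forall u v : 'I_p, D u -> D v ->
    @separated (fraction_graph p q) u v -> separated (f u) (f v).
Proof.
move=> Hf u v Du Dv; case: (ltngtP u v) => [uv|vu|uv] s.
- exact/separated_sym/Hf/separated_sym.
- exact: Hf.
- by case: s => + _; case; apply: val_inj.
Qed.

(** Rescaling by c / a multiplies circular distances by c / a, which sends b to
    at least d; taking floors keeps the bound because d is an integer. The
    inequalities g1 and g2 concern the two arcs between the vertices. *)
Lemma fraction_cohom_le (a b c d : nat) :
  (0 < c)%N -> (0 < b)%N -> (0 < d)%N -> (a * d <= c * b)%N ->
  cohom_le (fraction_graph a b) (fraction_graph c d).
Proof.
move=> c0 b0 d0 le_abcd.
have f_lt (i : 'I_a) : (i * c %/ a < c)%N.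
  by rewrite ltn_divLR; have := ltn_ord i; nia.
exists (fun i => Ordinal (f_lt i)).
suff S : forall u v : fraction_graph a b, true -> true -> separated u v ->
    @separated (fraction_graph c d) (Ordinal (f_lt u)) (Ordinal (f_lt v)).
  by move=> u v uv nuv; apply: S.
apply: (@fraction_separated_ltn _ _ _ (fun=> true)) => u v _ _ vu.
move=> /fraction_separatedP[]// h1 h2.
have a0 : (0 < a)%N by lia.
have g1 : (d + v * c %/ a <= u * c %/ a)%N.
  by rewrite -divnMDl// leq_div2r//; nia.
have g2 : (d + u * c %/ a <= c + v * c %/ a)%N.
  by rewrite -!divnMDl// leq_div2r//; nia.
apply/fraction_separatedP => //=; lia.
Qed.

(** Rescaling by p' / p shrinks a distance q only to q' - 1/p. Rounding down
    still gives q' unless the rescaled vertex at the start of the arc is an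
    integer, and since p and p' are coprime this happens at the vertex 0 only. *)
Lemma fraction_punctured_cohom (p q p' q' : nat) :
  (0 < q)%N -> (0 < q')%N -> (0 < p')%N -> (p * q' = q * p' + 1)%N ->
  exists f : fraction_graph p q -> fraction_graph p' q',
    forall u v : 'I_p, (0 < u)%N -> (0 < v)%N ->
      @separated (fraction_graph p q) u v -> separated (f u) (f v).
Proof.
move=> q0 q'0 p'0 bezout.
have p0 : (0 < p)%N by nia.
have f_lt (i : 'I_p) : (i * p' %/ p < p')%N.
  by rewrite ltn_divLR; have := ltn_ord i; nia.
have cop : coprime p p'.
  by apply/coprimeP => //; exists (q', q); rewrite /= mulnC bezout; lia.
have nz (i : 'I_p) : (0 < i)%N -> (0 < (i * p') %% p)%N.
  move=> i0; rewrite lt0n; apply/negP; rewrite -/(dvdn _ _) Gauss_dvdl//.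
  by move=> /(dvdn_leq i0); rewrite leqNgt ltn_ord.
exists (fun i => Ordinal (f_lt i)).
apply: (@fraction_separated_ltn _ _ _ (fun i => 0 < i)%N) => u v u0 v0 vu.
move=> /fraction_separatedP[]// h1 h2.
have := nz _ u0; have := nz _ v0.
have := divn_eq (u * p') p; have := divn_eq (v * p') p.
set A := (v * p' %/ p)%N; set B := (u * p' %/ p)%N => Ev Eu rv ru.
have g1 : (q' + A <= B)%N.
  rewrite /B leq_divRL//; nia.
have g2 : (q' + B <= p' + A)%N.
  rewrite /A -divnMDl// leq_divRL//; nia.
by apply/fraction_separatedP => //=; rewrite -/A -/B; lia.
Qed.

(** Fraction graphs are Cayley graphs of Z/p, so rotations preserve
    separation. *)
Lemma fraction_shift_separated (p q : nat) (a u v : 'I_p.+1) :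
  @separated (fraction_graph p.+1 q) u v ->
  @separated (fraction_graph p.+1 q) (u - a) (v - a).
Proof.
have subE (x : 'I_p.+1) : (nat_of_ord (x - a))%:Z = ((x%:Z - a%:Z) %% p.+1)%Z.
  have ap := ltn_ord a.
  rewrite /= modnDmr -modz_nat PoszD -subzn; last exact: ltnW.
  by rewrite -[RHS](modzMDl 1); congr (_ %% _)%Z; ring.
have modE (x y : 'I_p.+1) :
    (((nat_of_ord (x - a))%:Z - (nat_of_ord (y - a))%:Z) %% p.+1)%Z
      = ((x%:Z - y%:Z) %% p.+1)%Z.
  by rewrite !subE -modzDm modzNm !modz_mod modzDm; congr (_ %% _)%Z; ring.
move=> [uv nuv]; split=> [/addIr//|[_ h]]; apply: nuv; split=> //.
by rewrite -(modE u v) -(modE v u).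
Qed.

(** * Fractional cohomomorphisms *)

Definition partial_cohom (G H : graph) (D : G -> bool) (f : G -> H) :=
  forall u v, D u -> D v -> separated u v -> separated (f u) (f v).

(** A family of N partial cohomomorphisms, each vertex being in at least d of
    their domains: a cohomomorphism defined at each vertex only with
    probability d/N.
    The parameter X bounds the number of vertices of G through the surjection e
    from a finite type, which spares putting a finite structure on the vertices
    of iterated products. *)
Definition fractional_cohom (X N d : nat) (G H : graph) : Prop :=
  exists (T A : finType) (e : T -> G) (D : A -> G -> bool)
             (f : A -> G -> H),
    [/\ #|T| = X, #|A| = N, forall g, exists t, e t = g,
        forall a, partial_cohom (D a) (f a) &
        forall g, (d <= #|[pred a | D a g]|)%N].

(** The rotations of the punctured cohomomorphism: the a-th one omits the
    vertex a. *)
Lemma fractional_cohom_fraction (p q p' q' : nat) :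
  (0 < q)%N -> (0 < q')%N -> (0 < p')%N -> (p * q' = q * p' + 1)%N ->
  fractional_cohom p p p.-1 (fraction_graph p q) (fraction_graph p' q').
Proof.
case: p => [|p] q0 q'0 p'0 bezout; first by lia.
have [f fP] := fraction_punctured_cohom q0 q'0 p'0 bezout.
exists 'I_p.+1, 'I_p.+1, id, (fun a v => v != a), (fun a v => f (v - a)).
split=> [||g|a u v ua va uv|g]; rewrite ?card_ord//.
- by exists g.
- apply: fP; last exact: fraction_shift_separated.
  + by rewrite lt0n; move: ua; rewrite -subr_eq0.
  + by rewrite lt0n; move: va; rewrite -subr_eq0.
- by rewrite (eq_card (B := predC1 g)) ?cardC1 ?card_ord// => a;
    rewrite !inE eq_sym.
Qed.

Lemma fractional_cohom_strong (X N d X' N' d' : nat) (G H G' H' : graph) :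
  fractional_cohom X N d G H -> fractional_cohom X' N' d' G' H' ->
  fractional_cohom (X * X') (N * N') (d * d')
    (strong_product G G') (strong_product H H').
Proof.
move=> [T [A [e [D [f [TX AN eT fc Dd]]]]]].
move=> [T' [A' [e' [D' [f' [TX' AN' eT' fc' Dd']]]]]].
exists (T * T')%type, (A * A')%type, (fun t => (e t.1, e' t.2)).
exists (fun a g => D a.1 g.1 && D' a.2 g.2), (fun a g => (f a.1 g.1, f' a.2 g.2)).
split=> [||[g g']|[a a'] u v /andP[Du Du'] /andP[Dv Dv'] /separated_strong uv|[g g']].
- by rewrite card_prod TX TX'.
- by rewrite card_prod AN AN'.
- by have [t <-] := eT g; have [t' <-] := eT' g'; exists (t, t').
- apply/separated_strong; case: uv => uv /=.
  + by left; exact: fc.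
  + by right; exact: fc'.
- apply: leq_trans (leq_mul (Dd g) (Dd' g')) _.
  by rewrite -cardX; apply/eq_leq/eq_card.
Qed.

Lemma fractional_cohom_edgeless1 : fractional_cohom 1 1 1 (edgeless 1) (edgeless 1).
Proof.
exists 'I_1, 'I_1, id, (fun _ _ => true), (fun _ => id).
by split=> [||g|a u v|g]; rewrite ?card_ord//; exists g.
Qed.

(** Among the N domains, some one contains at least the average proportion d/N
    of the vertices that are still uncovered; selecting it k times in succession
    leaves at most X (1 - d/N)^k vertices uncovered. *)
Lemma fractional_cohom_greedy (X N d k : nat) (G H : graph) :
  (0 < N)%N -> fractional_cohom X N d G H ->
  exists (T A : finType) (e : T -> G) (D : A -> G -> bool)
         (f : A -> G -> H) (s : k.-tuple A),
    [/\ forall g, exists t, e t = g, forall a, partial_cohom (D a) (f a) &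
      (#|[pred t | ~~ has (D^~ (e t)) s]| * N ^ k <= X * (N - d) ^ k)%N].
Proof.
move=> N0 [T [A [e [D [f [TX AN eT fc Dd]]]]]].
exists T, A, e, D, f.
suff [s sP] : exists s : k.-tuple A,
    (#|[pred t | ~~ has (D^~ (e t)) s]| * N ^ k <= X * (N - d) ^ k)%N.
  by exists s.
elim: k => [|k [s sP]].
  exists [tuple]; rewrite !expn0 !muln1 -TX; exact: max_card.
set U := [pred t | ~~ has (D^~ (e t)) s] in sP *.
pose left a := #|[pred t in U | ~~ D a (e t)]|.
(* Double counting of the pairs (a, t) with t uncovered and missed by a. *)
have sum_left : (\sum_a left a <= #|U| * (N - d))%N.
  rewrite /left; under eq_bigr do rewrite -sum1_card big_mkcondr.
  rewrite exchange_big/= -sum_nat_const leq_sum// => t _.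
  rewrite -big_mkcond sum1_card -AN -(cardC [pred a | D a (e t)]).
  rewrite [X in (X <= _)%N](eq_card (B := [predC [pred a | D a (e t)]]))//.
  by rewrite -addnBAC; [exact: leq_addl|exact: Dd].
have [a0 _] : exists a : A, a \in predT by apply/card_gt0P; rewrite AN.
pose a := [arg min_(i < a0) left i].
have left_a : (left a * N <= #|U| * (N - d))%N.
  apply: leq_trans sum_left; rewrite mulnC -AN -sum_nat_const leq_sum// => i _.
  by rewrite /a; case: arg_minnP => // j _; exact.
exists [tuple of a :: s].
rewrite (eq_card (B := [pred t in U | ~~ D a (e t)])) -/(left a); last first.
  by move=> t; rewrite !inE/= negb_or andbC.
rewrite expnS mulnA (leq_trans (leq_mul left_a (leqnn _)))//.
by rewrite mulnAC expnSr mulnA leq_mul2r sP orbT.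
Qed.

(** Once k domains cover G, each vertex is sent to a copy of H labelled by a
    domain that contains it: vertices with different labels are separated in
    the edgeless factor, and those with the same label by the partial map. *)
Lemma fractional_cohom_le_strong (X N d k : nat) (G H : graph) :
  (0 < N)%N -> fractional_cohom X N d G H -> (X * (N - d) ^ k < N ^ k)%N ->
  cohom_le G (strong_product (edgeless k) H).
Proof.
move=> N0 rGH few.
have [T [A [e [D [f [s [eT fc sP]]]]]]] := fractional_cohom_greedy k N0 rGH.
have cov g : exists i : 'I_k, D (tnth s i) g.
  have [t <-] := eT g.
  have : ~~ [pred t | ~~ has (D^~ (e t)) s] t.
    apply/negP => /= nt.
    have : (0 < #|[pred t | ~~ has (D^~ (e t)) s]|)%N by apply/card_gt0P; exists t.
    have := leq_ltn_trans sP few; nia.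
  rewrite /= negbK => /hasP[a /tnthP[i ->]] ?; by exists i.
pose c g := projT1 (cid (cov g)).
have cP g : D (tnth s (c g)) g := projT2 (cid (cov g)).
exists (fun g => (c g, f (tnth s (c g)) g)) => u v uv nuv.
apply/separated_strong => /=.
have [cuv|cuv] := eqVneq (c u) (c v).
  right; rewrite -cuv; apply: fc => //; by rewrite cuv.
left; split=> [|//]; exact/eqP.
Qed.

(** * How many domains cover *)

Lemma bernoulli_expn (a d m : nat) :
  (a ^ m.+1 + m.+1 * d * a ^ m <= (a + d) ^ m.+1)%N.
Proof.
elim: m => [|m IH]; first by rewrite !expn1 expn0 mul1n muln1.
rewrite [((a + d) ^ m.+2)%N]expnS; apply: leq_trans (leq_mul (leqnn _) IH).
rewrite !expnS; set x := (a ^ m)%N; nia.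
Qed.

(** About N/d selections halve the uncovered part: with a = N - d, the first
    two terms of the expansion of (a + d)^m are each at least a^m when
    m d >= a. *)
Lemma halving_number (N d : nat) : (0 < d <= N)%N ->
  exists2 m, (m * d <= 2 * N)%N & (2 * (N - d) ^ m <= N ^ m)%N.
Proof.
move=> /andP[d0 dN]; exists (N %/ d).+1.
  by have := leq_divM N d; rewrite mulSn; lia.
have [a Na] : exists a, N = (a + d)%N by exists (N - d)%N; lia.
have md : (a <= (N %/ d).+1 * d)%N by have := ltn_ceil N d0; lia.
apply: leq_trans (_ : (a + d) ^ (N %/ d).+1 <= _)%N; last by rewrite -Na.
apply: leq_trans (bernoulli_expn _ _ _); rewrite {1}Na addnK expnS.
by set x := (a ^ _)%N; nia.
Qed.

(** Halving L times empties a set of fewer than 2^L elements. *)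
Lemma covering_number (X N d L : nat) : (0 < d <= N)%N -> (X < 2 ^ L)%N ->
  exists2 k, (k * d <= 2 * N * L)%N & (X * (N - d) ^ k < N ^ k)%N.
Proof.
move=> dN XL; have [m md half] := halving_number dN.
exists (m * L)%N; first by nia.
have N0 : (0 < N)%N by lia.
have [/eqP z|nz] := posnP ((N - d) ^ (m * L)); first by rewrite (eqP z) muln0 expn_gt0 N0.
apply: leq_trans (_ : 2 ^ L * (N - d) ^ (m * L) <= _)%N.
  by rewrite ltn_pmul2r.
by rewrite !expnM -expnMn; case: L {XL nz} => // L; rewrite leq_exp2r.
Qed.

(** * Consequences for spectral points *)

Section spectrum.
Variable R : realType.

Lemma bernoulli_exprn (t : R) m : 0 <= t -> 1 + m%:R * t <= (1 + t) ^+ m.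
Proof.
move=> t0; elim: m => [|m IH]; first by rewrite expr0; lra.
rewrite exprS -natr1; have m0 : 0 <= m%:R :> R by [].
nra.
Qed.

(** Linear factors do not affect exponential growth rates. With y = (1 + t) z,
    comparing exponents n = 2 m makes Bernoulli's inequality, squared, a
    quadratic lower bound in m. *)
Lemma le_of_exprn_le (C y z : R) : 0 <= z ->
  (forall n, y ^+ n <= C * n.+1%:R * z ^+ n) -> y <= z.
Proof.
move=> z0 yz; rewrite leNgt; apply/negP => zy.
have z_gt0 : 0 < z.
  rewrite lt_neqAle z0 andbT; apply/eqP => z00.
  by have := yz 1; rewrite -z00 !expr1 mulr0; lra.
have C0 : 0 <= C by have := yz 0; rewrite !expr0; lra.
pose t := (y - z) / z.
have t0 : 0 < t by rewrite divr_gt0// subr_gt0.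
have yE : y = (1 + t) * z by rewrite mulrDl divfK ?gt_eqF//; ring.
pose m := (Num.truncn (3 * C / t ^+ 2)).+1.
have mgt : 3 * C < m%:R * t ^+ 2.
  by rewrite -ltr_pdivrMr ?exprn_gt0// truncnS_gt.
have := yz (m * 2)%N; rewrite yE exprMn ler_pM2r ?exprn_gt0// exprM => le1.
have le2 := bernoulli_exprn m (ltW t0).
have m1 : 1 <= m%:R :> R by rewrite ler1n.
have : (1 + m%:R * t) ^+ 2 <= ((1 + t) ^+ m) ^+ 2.
  by rewrite ler_sqr// nnegrE ?exprn_ge0//; nra.
move=> /le_trans/(_ le1); rewrite -natr1 natrM; move: m%:R mgt m1 => M mgt m1.
have : C * (M * 2 + 1) <= C * (3 * M) by rewrite ler_wpM2l//; lra.
have : 3 * C * M < M * t ^+ 2 * M by rewrite ltr_pM2r//; lra.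
have : 0 <= M * t by nra.
nra.
Qed.

Definition ginf_pow (G : Ginf R) n := iter n (ginf_strong G) (ginf_edgeless R 1).

Lemma spectrum_pow F G n : asymp_spectrum F -> F (ginf_pow G n) = F G ^+ n.
Proof.
move=> [_ _ FM Fn _]; elim: n => [|n IH]; first by rewrite Fn expr0.
by rewrite /= FM -/(ginf_pow G n) IH exprS.
Qed.

Lemma fractional_cohom_pow X N d (G H : Ginf R) n : fractional_cohom X N d G H ->
  fractional_cohom (X ^ n) (N ^ n) (d ^ n) (ginf_pow G n) (ginf_pow H n).
Proof.
move=> rGH; elim: n => [|n IH]; first exact: fractional_cohom_edgeless1.
by rewrite !expnS; exact: fractional_cohom_strong.
Qed.

(** A vertex is mapped with probability d/N, and spectral points see this as
    the inequality F(G) d/N <= F(H). The tensor-power trick removes the loss of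
    a covering: in the n-th power the number of domains needed is
    (N/d)^n up to a factor linear in n. *)
Lemma fractional_cohom_spectrum X N d (G H : Ginf R) F :
  (0 < X)%N -> (0 < d <= N)%N ->
  fractional_cohom X N d G H -> asymp_spectrum F -> d%:R * F G <= N%:R * F H.
Proof.
move=> X0 dN rGH FX; have [F0 _ FM Fn Fle] := FX.
apply: (@le_of_exprn_le (2 * X%:R)); first by rewrite mulr_ge0.
move=> n; rewrite !exprMn.
have dNn : (0 < d ^ n <= N ^ n)%N.
  by case/andP: dN => d0 dN; rewrite expn_gt0 d0/=; case: (n) => // m; rewrite leq_exp2r.
have XL : (X ^ n < 2 ^ (X * n.+1))%N.
  rewrite expnM; apply: leq_ltn_trans (_ : X ^ n.+1 < _)%N.
    by rewrite leq_pexp2l.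
  by rewrite ltn_exp2r// ltn_expl.
have [k kd few] := covering_number dNn XL.
have : cohom_le (ginf_pow G n) (ginf_strong (ginf_edgeless R k) (ginf_pow H n)).
  apply: fractional_cohom_le_strong few; last exact: fractional_cohom_pow.
  by case/andP: dNn => ? ?; lia.
move=> /Fle; rewrite FM Fn !spectrum_pow// => GkH.
apply: le_trans (ler_wpM2l (exprn_ge0 _ (ler0n _ _)) GkH) _.
rewrite mulrA [leRHS]mulrA ler_wpM2r ?exprn_ge0//.
by rewrite -!natrX -!natrM ler_nat; nia.
Qed.

(** The supremum of an empty set of gaps is 0, whence the sign condition
    on e. *)
Lemma asymp_dist_le (G H : Ginf R) (e : R) : 0 <= e ->
  (forall F, asymp_spectrum F -> `|F G - F H| <= e) -> `|asymp_dist G H| <= e.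
Proof.
move=> e0 GH; rewrite /asymp_dist.
have [->|/set0P ne] := eqVneq (spectrum_gaps G H) set0.
  by rewrite sup0 normr0.
rewrite ger0_norm.
  by apply: ge_sup => // _ [F FX <-]; exact: GH.
have [d dGH] := ne; apply: le_trans (ub_le_sup (asymp_dist_has_ubound G H) dGH).
by case: dGH => F _ <-.
Qed.

End spectrum.

(** * The open circle graph *)

Section circle.
Variable R : realType.

Lemma open_circle_separatedP (r : R) (x y : open_circle_graph r) :
  0 < r -> val y < val x ->
  separated x y <-> 1 / r <= val x - val y /\ 1 / r <= 1 - (val x - val y).
Proof.
move=> r0 yx; rewrite /separated/= /open_circle_adj.
have -> : circle_dist x y = Num.min (val x - val y) (1 - (val x - val y)).
  by rewrite /circle_dist gtr0_norm ?subr_gt0.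
have ne : x <> y by move=> xy; rewrite xy ltxx in yx.
split=> [[_ na]|[h1 h2]].
  by apply/andP; rewrite -le_min leNgt; apply/negP => h; exact: na.
by split=> // -[_]; rewrite gt_min !ltNge h1 h2.
Qed.

(** The vertex i goes to the point i/p: graph distance q becomes
    q/p >= 1/r. *)
Lemma fraction_le_open_circle (p q : nat) (r : R) :
  (0 < q)%N -> 0 < r -> p%:R <= r * q%:R ->
  cohom_le (fraction_graph p q) (open_circle_graph r).
Proof.
move=> q0 r0 pq.
have in01 (i : 'I_p) : 0 <= (i%:R / p%:R : R) < 1.
  have ip := ltn_ord i; have p0 : 0 < p%:R :> R by rewrite ltr0n; lia.
  by rewrite divr_ge0//= ltr_pdivrMr// mul1r ltr_nat.
pose f (i : 'I_p) : circle R :=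
  exist (fun x : R => is_true (0 <= x < 1)) _ (in01 i).
suff S (u v : 'I_p) : true -> true -> @separated (fraction_graph p q) u v ->
    @separated (open_circle_graph r) (f u) (f v).
  by exists f => u v uv nuv; apply: S.
apply: (@fraction_separated_ltn _ _ (open_circle_graph r) (fun=> true) f).
move=> {}u {}v _ _ vu.
move=> /fraction_separatedP[]// h1 h2.
have p0 : 0 < p%:R :> R by rewrite ltr0n; lia.
have rq : 1 / r <= q%:R / p%:R.
  by rewrite ler_pdivlMr// mulrAC ler_pdivrMr// mul1r mulrC.
have e : (u%:R / p%:R - v%:R / p%:R : R) = (u - v)%N%:R / p%:R.
  by rewrite -mulrBl natrB// ltnW.
apply/open_circle_separatedP => //=; first by rewrite ltr_pM2r ?invr_gt0// ltr_nat.
rewrite e; split; apply: le_trans rq _.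
  by rewrite ler_pM2r ?invr_gt0// ler_nat.
by rewrite lerBrDr -mulrDl ler_pdivrMr// mul1r -natrD ler_nat.
Qed.

(** The point x goes to floor(x p): arcs of length 1/r become arcs of length
    p/r >= q, and q is an integer, so that taking floors keeps the bound. *)
Lemma open_circle_le_fraction (p q : nat) (r : R) :
  (0 < q)%N -> 0 < r -> r * q%:R <= p%:R ->
  cohom_le (open_circle_graph r) (fraction_graph p q).
Proof.
move=> q0 r0 rqp.
have qR : 0 < q%:R :> R by rewrite ltr0n.
have pR : 0 < p%:R :> R by nra.
have f_lt (x : circle R) : (Num.truncn (val x * p%:R) < p)%N.
  have /andP[x0 x1] := valP x.
  by rewrite truncn_lt_nat ?gtr_pMl// mulr_ge0// ltW.
suff S (x y : open_circle_graph r) : val y < val x -> separated x y ->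
    @separated (fraction_graph p q) (Ordinal (f_lt x)) (Ordinal (f_lt y)).
  exists (fun x => Ordinal (f_lt x)) => x y xy nxy.
  have sxy : separated x y by [].
  case: (ltgtP (val x) (val y)) => [lt_xy|lt_yx|e].
  - by apply/separated_sym/S => //; exact: separated_sym.
  - exact: S.
  - by case: xy; apply: val_inj.
move=> yx /open_circle_separatedP[]// h1 h2.
have qp : q%:R <= 1 / r * p%:R by rewrite mulrAC mul1r ler_pdivlMr// mulrC.
have x0 : 0 <= val x * p%:R by case/andP: (valP x) => h _; exact: mulr_ge0 h (ltW pR).
have y0 : 0 <= val y * p%:R by case/andP: (valP y) => h _; exact: mulr_ge0 h (ltW pR).
have /andP[xl _] := truncn_itv x0; have /andP[yl _] := truncn_itv y0.
have g1 : (q + Num.truncn (val y * p%:R) <= Num.truncn (val x * p%:R))%N.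
  by rewrite truncn_ge_nat// natrD; nra.
have g2 : (q + Num.truncn (val x * p%:R) <= p + Num.truncn (val y * p%:R))%N.
  rewrite -leq_subLR.
  have [le|/ltnW le] := leqP (q + Num.truncn (val x * p%:R)) p.
    by rewrite (eqP le).
  by rewrite truncn_ge_nat// natrB// natrD; nra.
have arcs (s t : nat) : (q + s <= t)%N -> (q + t <= p + s)%N ->
    [/\ (s < t)%N, (q <= t - s)%N & (q + (t - s) <= p)%N].
  by clear -q0 => qst qts; split; lia.
by have [lt_xy le1 le2] := arcs _ _ g1 g2; apply/fraction_separatedP.
Qed.

(** * Rational neighbours of an irrational number *)

(** For each denominator q the least numerator above r q is at a positive
    distance, and there are finitely many denominators up to N. *)
Lemma small_denominators_gap (r : R) N : 0 <= r ->
  exists2 e, 0 < e <= 1 & forall p q : nat, (q <= N)%N ->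
    ~ (r * q%:R < p%:R < (r + e) * q%:R).
Proof.
move=> r0; elim: N => [|N [e /andP[e0 e1] IH]].
  exists 1; first by rewrite ltr01 lexx.
  by move=> p q; rewrite leqn0 => /eqP->; rewrite !mulr0 => /andP[h1 h2]; lra.
have N0 : 0 < N.+1%:R :> R by rewrite ltr0n.
pose m := (Num.truncn (r * N.+1%:R)).+1.
have mr : r * N.+1%:R < m%:R by rewrite truncnS_gt.
pose e' := (m%:R - r * N.+1%:R) / N.+1%:R.
have e'0 : 0 < e' by rewrite divr_gt0// subr_gt0.
exists (Num.min e e'); first by rewrite lt_min e0 e'0 ge_min e1.
move=> p q; rewrite leq_eqVlt => /orP[/eqP-> /andP[h1 h2]|qN /andP[h1 h2]].
  have : (m <= p)%N by rewrite /m truncn_lt_nat// mulr_ge0// ltW.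
  rewrite -(ler_nat R); apply/negP; rewrite -ltNge (lt_le_trans h2)//.
  apply: le_trans (_ : (r + e') * N.+1%:R <= _).
    by rewrite ler_pM2r// lerD2l ge_min lexx orbT.
  by rewrite mulrDl /e' divfK ?gt_eqF//; lra.
apply: (IH p q) => //; rewrite h1 (lt_le_trans h2)//.
by rewrite ler_wpM2r// lerD2l ge_min lexx.
Qed.

(** The fraction p/q is the one of least denominator in the interval ]r, r + e[,
    with e so small that this denominator exceeds N; minimality makes it
    reduced. The Bezout coefficients q', p' then give a smaller fraction p'/q'
    with q' < q, which by minimality is outside the interval, hence on the left
    of r. *)
Lemma irrational_neighbours (r : R) (N : nat) :
  1 <= r -> irrational r ->
  exists p q p' q' : nat,
    [/\ [/\ (0 < q)%N, (0 < q')%N & (0 < p')%N], (N < p)%N,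
        (p * q' = q * p' + 1)%N,
        p'%:R < r * q'%:R & r * q%:R < p%:R < (r + 1) * q%:R].
Proof.
move=> r1 rirr; have r0 : 0 <= r by lra.
have [e /andP[e0 e1] gap] := small_denominators_gap N.+1 r0.
pose approx q := `[< exists p : nat, r * q%:R < p%:R < (r + e) * q%:R >].
have ex_approx : exists q, approx q.
  pose q := (Num.truncn (1 / e)).+1; exists q; apply/asboolP.
  have qe : 1 < q%:R * e by rewrite -ltr_pdivrMr// truncnS_gt.
  exists (Num.truncn (r * q%:R)).+1; rewrite truncnS_gt/= -natr1.
  have /truncn_itv/andP[h _] : 0 <= r * q%:R by rewrite mulr_ge0.
  by rewrite mulrDl; lra.
case: (ex_minnP ex_approx) => q /asboolP[p /andP[rqp pre]] qmin.
have qN : (N.+1 < q)%N.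
  by rewrite ltnNge; apply/negP => qN; apply: (gap p q) => //; rewrite rqp.
have qp : (q < p)%N.
  by rewrite -(ltr_nat R); apply: le_lt_trans rqp; rewrite ler_peMl.
have cop : gcdn p q = 1%N.
  have /dvdnP[p0 pE] := dvdn_gcdl p q; have /dvdnP[q0 qE] := dvdn_gcdr p q.
  have g0 : (0 < gcdn p q)%N by rewrite gcdn_gt0; lia.
  suff : (q <= q0)%N by nia.
  have pR : p%:R = p0%:R * (gcdn p q)%:R :> R by rewrite -natrM -pE.
  have qR : q%:R = q0%:R * (gcdn p q)%:R :> R by rewrite -natrM -qE.
  apply: qmin; apply/asboolP; exists p0; move: rqp pre.
  by rewrite pR qR !mulrA !ltr_pM2r ?ltr0n// => -> ->.
have [q' p' bezout p'p] := egcdnP q (leq_ltn_trans (leq0n _) qp).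
rewrite cop in bezout p'p.
have q'0 : (0 < q')%N by nia.
have p'0 : (0 < p')%N by nia.
have q'q : (q' < q)%N by nia.
have q0 : (0 < q)%N by lia.
exists p, q, p', q'; split=> //; [lia|nia| |].
- have q0R : 0 < q%:R :> R by rewrite ltr0n; lia.
  have q'0R : 0 < q'%:R :> R by rewrite ltr0n.
  have lt1 : p'%:R * q%:R < p%:R * q'%:R :> R by rewrite -!natrM ltr_nat; nia.
  rewrite ltNge le_eqVlt; apply/negP => /orP[/eqP rE|rq'].
    apply: rirr; apply/rationalP; exists p'%:Z, q'.
    by rewrite -[p'%:~R]/(p'%:R) -rE mulfK// gt_eqF.
  suff : (q <= q')%N by rewrite leqNgt q'q.
  apply: qmin; apply/asboolP; exists p'; rewrite rq'/=.
  by rewrite -(ltr_pM2r q0R) (lt_trans lt1)// mulrAC ltr_pM2r.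
- by rewrite rqp (lt_le_trans pre)// ler_wpM2r// lerD2l.
Qed.

End circle.

(** * Convergence *)

Theorem theorem1p3 (R : realType) (r : R) (r2 : 2 <= r)
    (r_irrational : irrational r) (p q : nat -> nat)
    (p_gt0 : forall n, (0 < p n)%N) (q_gt0 : forall n, (0 < q n)%N)
    (pq_ge2 : forall n, 2 <= (p n)%:R / (q n)%:R :> R)
    (pq_cvg : ((p n)%:R / (q n)%:R : R) @[n --> \oo] --> r) :
  asymp_dist (ginf_fraction R (p n) (q n)) (ginf_open_circle r2)
    @[n --> \oo] --> (0 : R).
Proof.
apply/cvgrPdist_le => e e0.
have r0 : 0 < r by lra.
pose M := (Num.truncn (r + 1)).+1.
have rM : r + 1 < M%:R by rewrite truncnS_gt.
(* As b/a < r + 1 gives F(E_(b/a)) <= M and the gap is at most F(E_(b/a)) / b,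
   it suffices that b >= M / e. *)
pose N := Num.truncn (M%:R / e).
have [b [a [b' [a' [[a0 a'0 b'0] Nb bezout b'a' /andP[ab ba]]]]]] :=
  @irrational_neighbours R r N.+1 ltac:(lra) r_irrational.
have b0 : (0 < b)%N := leq_ltn_trans (leq0n _) Nb.
have b1 : (0 < b.-1 <= b)%N by rewrite leq_pred andbT -ltnS prednK// (leq_trans _ Nb).
have aR : 0 < a%:R :> R by rewrite ltr0n.
have a'R : 0 < a'%:R :> R by rewrite ltr0n.
have lo : b'%:R / a'%:R < r by rewrite ltr_pdivrMr.
have hi : r < b%:R / a%:R by rewrite ltr_pdivlMr.
near=> n.
have pqn_lo : b'%:R / a'%:R < (p n)%:R / (q n)%:R :> R.
  by near: n; exact: cvgr_gt lo.
have pqn_hi : (p n)%:R / (q n)%:R < b%:R / a%:R :> R.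
  by near: n; exact: cvgr_lt hi.
have qR : 0 < (q n)%:R :> R by rewrite ltr0n.
rewrite sub0r normrN; apply: asymp_dist_le => [|F FX]; first exact: ltW.
have [F0 _ _ Fn Fle] := FX.
have lowP : F (ginf_fraction R b' a') <= F (ginf_fraction R (p n) (q n)).
  apply/Fle/fraction_cohom_le => //.
  by move: pqn_lo; rewrite ltr_pdivrMr// mulrAC ltr_pdivlMr// -!natrM ltr_nat => /ltnW.
have highP : F (ginf_fraction R (p n) (q n)) <= F (ginf_fraction R b a).
  apply/Fle/fraction_cohom_le => //.
  by move: pqn_hi; rewrite ltr_pdivrMr// mulrAC ltr_pdivlMr// -!natrM ltr_nat => /ltnW.
have lowC : F (ginf_fraction R b' a') <= F (ginf_open_circle r2).
  by apply/Fle/fraction_le_open_circle => //; exact: ltW.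
have highC : F (ginf_open_circle r2) <= F (ginf_fraction R b a).
  by apply/Fle/open_circle_le_fraction => //; exact: ltW.
have bound : F (ginf_fraction R b a) <= M%:R.
  (* E_(M/1) is edgeless. *)
  rewrite -Fn; apply: (@le_trans _ _ (F (ginf_fraction R M 1))); apply: Fle.
    apply: fraction_cohom_le => //.
    by rewrite muln1 -(ler_nat R) natrM; nra.
  by exists id => u v uv _; split.
have close : b.-1%:R * F (ginf_fraction R b a) <= b%:R * F (ginf_fraction R b' a').
  by apply: (fractional_cohom_spectrum b0 b1 _ FX); exact: fractional_cohom_fraction.
have bE : b%:R = b.-1%:R + 1 :> R by rewrite natr1 prednK.
have Me : M%:R <= e * b%:R.
  rewrite mulrC -ler_pdivrMr// ltW// (lt_trans (truncnS_gt _))// ltr_nat//.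
have bR : 0 < b%:R :> R by rewrite ltr0n.
have small : F (ginf_fraction R b a) - F (ginf_fraction R b' a') <= e.
  by rewrite -(ler_pM2l bR); nra.
by rewrite ler_norml; apply/andP; split; lra.
Unshelve. all: by end_near.
Qed.
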